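(* Let $\mathfrak{A}$ be a unital $C^*$-algebra, $a\in\mathfrak{A}$ a nonzero positive element, and let $x\in\mathfrak{A}_a$. Then $$\frac14\left\|xx^{\sharp_a}+x^{\sharp_a}x\right\|_a\le\frac12\Big(v_a^2(x)+d_a^2(x)\Big)\le v_a^2(x).$$
   Context: $\mathcal{S}(\mathfrak{A})$ is the set of states of $\mathfrak{A}$ and $\mathcal{S}_a(\mathfrak{A})=\{f/f(a): f\in\mathcal{S}(\mathfrak{A}),\ f(a)\ne 0\}$. For $x\in\mathfrak{A}$, $\|x\|_a=\sup\{\sqrt{f(x^*ax)}: f\in\mathcal{S}_a(\mathfrak{A})\}\in[0,\infty]$, and the $a$-numerical radius is $v_a(x)=\sup\{|f(ax)|: f\in\mathcal{S}_a(\mathfrak{A})\}$. An element $x^{\sharp_a}\in\mathfrak{A}$ is an $a$-adjoint of $x$ if $ax^{\sharp_a}=x^*a$; $\mathfrak{A}_a$ is the set of all elements of $\mathfrak{A}$ admitting an $a$-adjoint (a subalgebra of $\mathfrak{A}$ on which $\|\cdot\|_a$ is a finite semi-norm). $a$-adjoints need not be unique; $x^{\sharp_a}$ denotes an $a$-adjoint of $x$, and the quantities in the claim do not depend on the choice. For $x\in\mathfrak{A}_a$, $d_a(x)=\inf_{\zeta\in\mathbb{C}}v_a(x-\zeta\mathbf{1})$, where $\mathbf{1}$ is the unit of $\mathfrak{A}$. $v_a^2(x)$ and $d_a^2(x)$ mean $(v_a(x))^2$ and $(d_a(x))^2$. *)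

(* Defs.v *)
From HB Require Import structures.
From mathcomp Require Import all_boot all_order all_algebra.
From mathcomp Require Import complex.
From mathcomp Require Import all_classical all_reals all_analysis.
Import Order.TTheory GRing.Theory Num.Theory.
Import Normc.

Set Implicit Arguments.
Unset Strict Implicit.
Unset Printing Implicit Defensive.

Local Open Scope classical_set_scope.
Local Open Scope ring_scope.
Local Open Scope complex_scope.

(* Unital C*-algebras. The norm [cnorm] is a field of its own: Hierarchy-Builder
   admits no join of [GRing.Algebra] and [NormedModule] above [Num.NumDomain].
   Nonnegativity of [cnorm] follows from [cnormD] and [cnormZ].
   The last field is completeness: Cauchy sequences converge. *)
HB.mixin Record isCStarAlgebra (R : realType) A of GRing.Algebra R[i] A := {
  star : A -> A ;
  starK : forall x, star (star x) = x ;
  starD : forall x y, star (x + y) = star x + star y ;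
  starZ : forall (c : R[i]) x, star (c *: x) = c^*%C *: star x ;
  starM : forall x y, star (x * y) = star y * star x ;
  cnorm : A -> R ;
  cnorm_eq0 : forall x, cnorm x = 0 -> x = 0 ;
  cnormD : forall x y, cnorm (x + y) <= cnorm x + cnorm y ;
  cnormZ : forall (c : R[i]) x, cnorm (c *: x) = normc c * cnorm x ;
  cnormM : forall x y, cnorm (x * y) <= cnorm x * cnorm y ;
  cnorm_star : forall x, cnorm (star x * x) = cnorm x ^+ 2 ;
  cnorm_complete : forall u : nat -> A,
    (forall e : R, 0 < e -> exists N : nat, forall m n : nat,
        (N <= m)%N -> (N <= n)%N -> cnorm (u m - u n) < e) ->
    exists l : A, forall e : R, 0 < e -> exists N : nat, forall n : nat,
        (N <= n)%N -> cnorm (u n - l) < e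
}.

#[short(type="cstarAlgType")]
HB.structure Definition CStarAlgebra (R : realType) :=
  { A of isCStarAlgebra R A & GRing.Algebra R[i] A }.

Section ANumericalRadius.
Context {R : realType} {A : cstarAlgType R}.
Implicit Types (a x y : A) (z : R[i]).

Definition positive_elt x := exists y, x = star y * y.

(* [0 <= z] in [R[i]] means that [z] is a nonnegative real. Positive functionals
   on a unital C*-algebra are automatically bounded, of norm [f 1]. *)
Definition states : set {scalar A} :=
  [set f | (forall x, positive_elt x -> 0 <= f x) /\ f 1 = 1].

Definition astates a : set (A -> R[i]) :=
  [set (fun x => f x / f a) | f in [set f : {scalar A} | states f /\ f a != 0]].

(* For positive [a], [f (star x * a * x)] is a nonnegative real, so that taking
   its real part loses no information. *)
Definition anorm a x : \bar R :=
  ereal_sup [set (Num.sqrt (complex.Re (f (star x * a * x))))%:E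
            | f in astates a].

Definition aradius a x : \bar R :=
  ereal_sup [set (normc (f (a * x)))%:E | f in astates a].

Definition is_aadjoint a x y := a * y = star x * a.

Definition aadjointable a : set A := [set x | exists y, is_aadjoint a x y].

Definition adist a x : \bar R :=
  ereal_inf [set aradius a (x - z *: 1) | z in [set: R[i]]].

End ANumericalRadius.

(* Main.v *)
(** Every [f] in [astates a] makes [(u, v) |-> f (star u * a * v)] a positive
    semidefinite form, and [f (star u * _ * u)] is, up to normalization, again
    in [astates a] (or vanishes on [a]). If [star h * a = a * h] and
    [|f (a * h)| <= V] for all such [f], the parallelogram trick for numerical
    ranges gives [f (star (h * u) * a * (h * u)) <= V ^ 2 f (star u * a * u)],
    hence [h * h] has [a]-norm at most [V ^ 2].

    Write [x = h + i k] with [h = (x + xs) / 2] and [k = (x - xs) / 2i], so that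
    [x * xs + xs * x = 2 (h * h + k * k)]. Then [f (a * h)] and [f (a * k)] are
    the real and imaginary parts of [f (a * x)]. The left-hand side does not
    change when [x] is multiplied by a unimodular scalar, which may be chosen so
    that a given [z] becomes real; then [x] and [x - z] have the same [k], whence
    [|f (a * h)| <= v_a x] and [|f (a * k)| <= v_a (x - z)]. *)

Require Import Defs.
From HB Require Import structures.
From mathcomp Require Import all_boot all_order all_algebra.
From mathcomp Require Import complex.
From mathcomp Require Import all_classical all_reals all_analysis.
From mathcomp Require Import ring lra.
Import Order.TTheory GRing.Theory Num.Theory.

Local Open Scope classical_set_scope.
Local Open Scope ring_scope.

(** * The involution, conjugated functionals and unimodular scalars *)

Section StarAlgebra.
Import Normc.
Context {R : realType} {A : cstarAlgType R}.
Implicit Types (a b u v w x y : A) (F G : {scalar A}) (c z : R[i]).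

Lemma star1 : star (1 : A) = 1.
Proof. by rewrite -[RHS]starK -[star 1 in RHS]mul1r starM starK mul1r. Qed.

Lemma starN x : star (- x) = - star x.
Proof. by rewrite -scaleN1r starZ rmorphN1 scaleN1r. Qed.

Lemma starB x y : star (x - y) = star x - star y.
Proof. by rewrite starD starN. Qed.

Lemma positive_elt_star x : positive_elt x -> star x = x.
Proof. by case=> y ->; rewrite starM starK. Qed.

Lemma Re_realM (t : R) z : complex.Re (t%:C%C * z) = t * complex.Re z.
Proof. by case: z => p q /=; ring. Qed.

Lemma conj_real (t : R) : (t%:C%C)^*%C = t%:C%C :> R[i].
Proof. by rewrite /= oppr0. Qed.

Definition pos_functional F := forall y, 0 <= F (star y * y).

(** With [u = 1] this rescales [F]; with [c = 1] it transports estimates to [F (star u * _ * u)].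
    Positivity persists because [star u * (star y * y) * u] is [star (y * u) * (y * u)]. *)
Lemma pos_functional_conj {F} u {c} : 0 <= c -> pos_functional F ->
  exists G, pos_functional G /\ forall y, G y = c * F (star u * y * u).
Proof.
move=> c0 Fp; pose g y := c * F (star u * y * u).
have glin : GRing.linear_for *%R g.
  move=> k y z; rewrite /g mulrDr mulrDl -scalerAr -scalerAl linearP.
  by rewrite mulrDr mulrCA.
pose gM := GRing.isLinear.Build _ _ _ _ g glin.
pose G : {scalar A} := HB.pack g gM.
exists G; split=> // y; rewrite /= /g mulr_ge0//.
by have := Fp (y * u); rewrite starM !mulrA.
Qed.

Lemma Re_quad_add F (t : R) m u v :
  complex.Re (F (star (t%:C%C *: u + v) * m * (t%:C%C *: u + v))) =
  t ^+ 2 * complex.Re (F (star u * m * u))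
  + t * (complex.Re (F (star u * m * v)) + complex.Re (F (star v * m * u)))
  + complex.Re (F (star v * m * v)).
Proof.
rewrite starD starZ conj_real !mulrDl !mulrDr -!scalerAl -!scalerAr.
by rewrite !linearD !linearZ /= !Re_realM; ring.
Qed.

Lemma normr_Re_le_normc z : `|complex.Re z| <= normc z.
Proof.
by case: z => p q /=; rewrite -sqrtr_sqr ler_wsqrtr// lerDl sqr_ge0.
Qed.

Lemma normr_Im_le_normc z : `|complex.Im z| <= normc z.
Proof.
by case: z => p q /=; rewrite -sqrtr_sqr ler_wsqrtr// lerDr sqr_ge0.
Qed.

Lemma rotate_to_real z :
  exists t, [/\ normc t = 1, t * t^*%C = 1 & complex.Im (t * z) = 0].
Proof.
have [->|z0] := eqVneq z 0.
  by exists 1; rewrite normc1 rmorph1 mulr1 mulr0.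
have r0 : normc z != 0 by apply: contra_neq z0; apply: eq0_normc.
have r2 : normc z ^+ 2 = complex.Re z ^+ 2 + complex.Im z ^+ 2.
  by case: z {z0 r0} => p q /=; rewrite sqr_sqrtr// addr_ge0// sqr_ge0.
case: z (normc z) r0 r2 {z0} => p q r r0 /= r2.
have tt : (p / r) ^+ 2 + (q / r) ^+ 2 = 1.
  by rewrite !expr_div_n -mulrDl -r2 divff// sqrf_eq0.
(* The conjugate of [z] divided by its modulus. *)
exists (p / r +i* - (q / r))%C; split.
- by rewrite /= sqrrN tt sqrtr1.
- apply/eqP; rewrite eq_complex /=; apply/andP; split; apply/eqP; last by ring.
  by rewrite -tt; ring.
- by rewrite /=; ring.
Qed.

(** * Hermitian symmetry and the Cauchy-Schwarz inequality *)

Section PositiveFunctional.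
Context {F} (Fp : pos_functional F).

(** Polarization: the values of [F] at the squares of [u], [v], [v + u] and [v + i u] are real,
    which leaves two linear equations between the mixed terms. *)
Lemma pos_functionalC u v : F (star v * u) = (F (star u * v))^*%C.
Proof.
have := Fp (v + u); have := Fp (v + 'i%C *: u); have := Fp u; have := Fp v.
rewrite !starD starZ !mulrDl !mulrDr -!scalerAr -!scalerAl !linearD !linearZ.
rewrite /= -/(@complex.conjc R).
case: (F (star u * u)) => a1 a2; case: (F (star v * v)) => b1 b2.
case: (F (star u * v)) => p q; case: (F (star v * u)) => r s.
rewrite !lecE /= => /andP[/eqP-> _] /andP[/eqP-> _] /andP[/eqP e1 _] /andP[/eqP e2 _].
by congr (_ +i* _)%C; lra.
Qed.

Lemma pos_functional_Re_ge0 u : 0 <= complex.Re (F (star u * u)).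
Proof. by have := Fp u; rewrite lecE => /andP[]. Qed.

Lemma pos_functional_Re u : F (star u * u) = (complex.Re (F (star u * u)))%:C%C.
Proof.
by have := Fp u; case: (F _) => p q; rewrite lecE /= => /andP[/eqP-> _].
Qed.

Lemma pos_functional_Re_add (t : R) u v :
  complex.Re (F (star (t%:C%C *: u + v) * (t%:C%C *: u + v))) =
  t ^+ 2 * complex.Re (F (star u * u)) + 2 * t * complex.Re (F (star u * v))
  + complex.Re (F (star v * v)).
Proof.
have := Re_quad_add F t 1 u v; rewrite !mulr1 => ->.
by rewrite (pos_functionalC u v); case: (F (star u * v)) => p q /=; ring.
Qed.

(** The polynomial in [t] from [pos_functional_Re_add] is nonnegative on the real line. *)
Lemma pos_functional_CauchySchwarz u v :
  complex.Re (F (star u * v)) ^+ 2 <=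
  complex.Re (F (star u * u)) * complex.Re (F (star v * v)).
Proof.
have H t := pos_functional_Re_ge0 (t%:C%C *: u + v).
have {}H t : 0 <= _ := eq_ind _ (fun r => 0 <= r) (H t) _ (pos_functional_Re_add t u v).
have uu := pos_functional_Re_ge0 u.
move: (complex.Re (F (star u * u))) (complex.Re (F (star u * v)))
  (complex.Re (F (star v * v))) uu H => p q r; rewrite le_eqVlt.
case/orP=> [/eqP <- | p0] H.
  rewrite mul0r; have [->|q0] := eqVneq q 0; first by rewrite expr0n.
  (* The polynomial is now affine with slope [2 * q]; this [t] makes it [-1]. *)
  have := H (- (r + 1) / (2 * q)).
  have -> : (- (r + 1) / (2 * q)) ^+ 2 * 0 + 2 * (- (r + 1) / (2 * q)) * q + r = -1.
    by field.
  by lra.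
(* The minimizer of the polynomial. *)
have := H (- q / p).
have -> : (- q / p) ^+ 2 * p + 2 * (- q / p) * q + r = (p * r - q ^+ 2) / p.
  by field; rewrite gt_eqF.
by rewrite pmulr_lge0 ?invr_gt0// subr_ge0.
Qed.

End PositiveFunctional.

(** * Functionals normalized at [a] and estimates for the [a]-semi-norm *)

Section AStates.
Context {a} (a_pos : positive_elt a).

Lemma pos_functional_elt F : pos_functional F -> F a = (complex.Re (F a))%:C%C.
Proof. by move=> Fp; case: a_pos => y ->; apply: pos_functional_Re. Qed.

Lemma pos_functional_elt_ge0 F : pos_functional F -> 0 <= complex.Re (F a).
Proof. by move=> Fp; case: a_pos => y ->; apply: pos_functional_Re_ge0. Qed.

(** Elements of [astates a] are bare functions; linearity and positivity are recovered by absorbing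
    the nonnegative factor [(g a)^-1] into the functional. *)
Lemma astates_functional f : astates a f ->
  exists F, [/\ pos_functional F, F a = 1 & f = F].
Proof.
case=> g [[gp g1] ga <-].
have {}gp : pos_functional g by move=> y; apply: gp; exists y.
have c0 : 0 <= (g a)^-1.
  by rewrite invr_ge0 (pos_functional_elt _ gp) lecR pos_functional_elt_ge0.
have [G [Gp GE]] := pos_functional_conj 1 c0 gp.
exists G; split=> //; first by rewrite GE star1 mul1r mulr1 mulVf.
by apply/funext => y; rewrite GE star1 mul1r mulr1 mulrC.
Qed.

Lemma functional_astates F : pos_functional F -> F a != 0 ->
  astates a (fun y => F y / F a).
Proof.
move=> Fp Fa0.
(* Needed to normalize [F] to a state: by Cauchy-Schwarz for [1] and [a], [F 1 = 0] would force
   [F a = 0]. *)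
have F1 : F 1 != 0.
  apply: contra_neq Fa0 => F1.
  have := pos_functional_CauchySchwarz Fp 1 a.
  rewrite star1 !mul1r F1 mul0r => Fa.
  have /eqP := le_anti (introT andP (conj Fa (sqr_ge0 _))).
  by rewrite sqrf_eq0 (pos_functional_elt _ Fp) => /eqP ->.
have c0 : 0 <= (F 1)^-1.
  by rewrite invr_ge0; have := Fp 1; rewrite star1 mulr1.
have [G [Gp GE]] := pos_functional_conj 1 c0 Fp.
have {}GE y : G y = (F 1)^-1 * F y by rewrite GE star1 mul1r mulr1.
exists G => /=.
  split; last by rewrite GE mulf_neq0 ?invr_eq0.
  by split=> [_ [y ->]|]; [exact: Gp | rewrite GE mulVf].
by apply/funext => y; rewrite !GE; field; rewrite F1 Fa0.
Qed.

(** Homogeneity if [F a] is nonzero. Otherwise, with [a = star b * b], Cauchy-Schwarz for [b] and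
    [b * y] makes the left side vanish. *)
Lemma astates_functional_bound (V : R) y F :
  (forall f, astates a f -> `|complex.Re (f (a * y))| <= V) ->
  pos_functional F -> `|complex.Re (F (a * y))| <= V * complex.Re (F a).
Proof.
move=> yV Fp; have [Fa0|Fa0] := eqVneq (F a) 0.
  rewrite Fa0 mulr0; case: a_pos Fa0 => b -> Fa0.
  have := pos_functional_CauchySchwarz Fp b (b * y).
  rewrite Fa0 mul0r mulrA => Fay.
  have /eqP := le_anti (introT andP (conj Fay (sqr_ge0 _))).
  by rewrite sqrf_eq0 => /eqP ->; rewrite normr0.
have := yV _ (functional_astates _ Fp Fa0).
have := pos_functional_elt_ge0 _ Fp; rewrite (pos_functional_elt _ Fp) in Fa0 *.
rewrite le_eqVlt => /orP[/eqP r0|r0]; first by rewrite -r0 eqxx in Fa0.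
rewrite -fmorphV mulrC Re_realM normrM normfV (gtr0_norm r0).
by rewrite /= mulrC ler_pdivrMr.
Qed.

(** Triangle inequality in squared form: for [a = star b * b] it reduces to Cauchy-Schwarz for
    [b * u] and [b * v]. *)
Lemma pos_functional_MinkowskiRe F u v (V W : R) : pos_functional F ->
  0 <= V -> 0 <= W ->
  complex.Re (F (star u * a * u)) <= V ^+ 2 ->
  complex.Re (F (star v * a * v)) <= W ^+ 2 ->
  complex.Re (F (star (u + v) * a * (u + v))) <= (V + W) ^+ 2.
Proof.
move=> Fp V0 W0; case: a_pos => b ->.
have aE w y : star w * (star b * b) * y = star (b * w) * (b * y).
  by rewrite starM !mulrA.
rewrite !aE => uV vW; have := pos_functional_Re_add Fp 1 (b * u) (b * v).
rewrite scale1r -mulrDr => ->.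
have := pos_functional_CauchySchwarz Fp (b * u) (b * v).
have := pos_functional_Re_ge0 Fp (b * u); have := pos_functional_Re_ge0 Fp (b * v).
move: (complex.Re (F (star (b * u) * (b * u)))) uV
  (complex.Re (F (star (b * v) * (b * v)))) vW
  (complex.Re (F (star (b * u) * (b * v)))) => p pV q qW r q0 p0 rpq.
have : `|r| <= V * W.
  rewrite -ler_sqr ?nnegrE ?mulr_ge0// real_normK ?num_real// exprMn.
  by rewrite (le_trans rpq)// ler_pM.
rewrite ler_norml => /andP[_ rVW].
have -> : 1 ^+ 2 * p + 2 * 1 * r + q = p + q + 2 * r by ring.
have -> : (V + W) ^+ 2 = V ^+ 2 + W ^+ 2 + 2 * (V * W) by ring.
by lra.
Qed.

Lemma a_selfadjoint_bound (V : R) h F u :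
  (forall f, astates a f -> `|complex.Re (f (a * h))| <= V) ->
  0 <= V -> star h * a = a * h -> pos_functional F ->
  complex.Re (F (star (h * u) * a * (h * u))) <=
  V ^+ 2 * complex.Re (F (star u * a * u)).
Proof.
move=> hV V0 ha Fp.
have wV w : `|complex.Re (F (star w * (a * h) * w))| <=
    V * complex.Re (F (star w * a * w)).
  have [G [Gp GE]] := pos_functional_conj w ler01 Fp.
  by have := astates_functional_bound _ _ _ hV Gp; rewrite !GE !mul1r.
(* Below, [w = t (h u) + u] and [w = - t (h u) + u] are subtracted, then t = 1 / V. *)
pose S := complex.Re (F (star (h * u) * a * (h * u))).
have {}wV t := wV (t%:C%C *: (h * u) + u).
have ahu : star (h * u) * (a * h) * u = star (h * u) * a * (h * u).
  by rewrite !mulrA.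
have uah : star u * (a * h) * (h * u) = star (h * u) * a * (h * u).
  by rewrite starM -ha !mulrA.
have St t : 2 * t * S <= V * (t ^+ 2 * S + complex.Re (F (star u * a * u))).
  have := wV t; have := wV (- t); rewrite !Re_quad_add ahu uah -/S sqrrN !ler_norml.
  move=> /andP[+ _] /andP[_ +].
  move: (complex.Re (F (star u * a * (h * u)))) (complex.Re (F (star (h * u) * a * u))).
  move: (complex.Re (F (star u * a * u))) (t ^+ 2) => U t2 k k'.
  by lra.
rewrite -/S; move: V0; rewrite le_eqVlt => /orP[/eqP V0|V0].
  (* For [V = 0] the right side of [St] vanishes, so any positive [t] serves. *)
  by have := St 1; rewrite -V0 mul0r expr0n mul0r; lra.
have := St V^-1.
move: (complex.Re _) => U.
have -> : 2 * V^-1 * S = 2 * S / V by ring.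
have -> : V * ((V^-1) ^+ 2 * S + U) = (S + V ^+ 2 * U) / V.
  by field; rewrite gt_eqF.
by rewrite ler_pM2r ?invr_gt0//; lra.
Qed.

Lemma anorm_anticomm_bound (V W : R) x xs F : is_aadjoint a x xs ->
  0 <= V -> 0 <= W ->
  (forall f, astates a f -> `|complex.Re (f (a * x))| <= V) ->
  (forall f, astates a f -> `|complex.Im (f (a * x))| <= W) ->
  pos_functional F -> F a = 1 ->
  Num.sqrt (complex.Re (F (star (x * xs + xs * x) * a * (x * xs + xs * x)))) <=
  2 * (V ^+ 2 + W ^+ 2).
Proof.
move=> xsP V0 W0 xV xW Fp Fa1.
have aS := positive_elt_star _ a_pos.
have xsa : star xs * a = a * x by rewrite -[LHS]starK starM starK aS xsP starM aS starK.
have Faxs G : pos_functional G -> G (a * xs) = (G (a * x))^*%C.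
  move=> Gp; rewrite xsP.
  by have := pos_functionalC Gp 1 (a * x); rewrite star1 !mul1r mulr1 starM aS => <-.
(* [i2] is [1 / (2i)]. *)
pose i2 : R[i] := (0 +i* - 2^-1)%C.
pose h := 2^-1%:C%C *: (x + xs); pose k := i2 *: (x - xs).
have hV f : astates a f -> `|complex.Re (f (a * h))| <= V.
  move=> fa; have := xV f fa; have [G [Gp Ga ->]] := astates_functional _ fa.
  rewrite /h -scalerAr linearZ mulrDr linearD Faxs//=.
  case: (G (a * x)) => p q /=.
  by congr (`| _ | <= _); lra.
have kW f : astates a f -> `|complex.Re (f (a * k))| <= W.
  move=> fa; have := xW f fa; have [G [Gp Ga ->]] := astates_functional _ fa.
  rewrite /k -scalerAr linearZ mulrBr linearB Faxs//=.
  case: (G (a * x)) => p q /=.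
  by congr (`| _ | <= _); lra.
have ha : star h * a = a * h.
  by rewrite /h starZ starD conj_real -scalerAl -scalerAr mulrDl mulrDr -xsP xsa addrC.
have ka : star k * a = a * k.
  rewrite /k starZ starB -scalerAl -scalerAr mulrBl mulrBr -xsP xsa -[RHS]opprK -scalerN opprB -scaleNr.
  by congr (_ *: _); apply/eqP; rewrite /i2 eq_complex /= oppr0 !eqxx.
have hkE : x * xs + xs * x = 2%:C%C *: (h * h + k * k).
  have e1 : 2%:C%C * (2^-1%:C%C * 2^-1%:C%C) = 2^-1%:C%C :> R[i].
    by rewrite -!rmorphM; congr (_%:C)%C; field.
  have e2 : 2%:C%C * (i2 * i2) = - 2^-1%:C%C :> R[i].
    by rewrite /i2; apply/eqP; rewrite eq_complex /=; apply/andP; split; apply/eqP; field.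
  rewrite /h /k -!scalerAl -!scalerAr !scalerA scalerDr !scalerA e1 e2 scaleNr -scalerBr.
  have -> : (x + xs) * (x + xs) - (x - xs) * (x - xs) = (x * xs + xs * x) *+ 2.
    rewrite [(x + xs) * _]mulrDl [(x - xs) * _]mulrBl opprD opprK addrACA -mulrBr -mulrDr.
    by rewrite {1}[x + xs]addrC addrKA opprK addrACA subrr addr0 -!mulr2n !mulrnAr -mulrnDl.
  rewrite -scalerMnr scalerMnl -rmorphMn /= (_ : _ *+ 2 = 1) ?scale1r//.
  by rewrite -mulr_natr mulVf.
(* [a_selfadjoint_bound] is applied twice, at [u = y] and then at [u = 1], where [F a = 1] ends the
   chain. *)
have bound y Y : (forall f, astates a f -> `|complex.Re (f (a * y))| <= Y) ->
    0 <= Y -> star y * a = a * y ->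
    complex.Re (F (star (y * y) * a * (y * y))) <= (Y ^+ 2) ^+ 2.
  move=> yY Y0 ya; apply: le_trans (a_selfadjoint_bound _ _ _ _ yY Y0 ya Fp) _.
  rewrite [leRHS]expr2; apply: ler_wpM2l; first exact: sqr_ge0.
  have := a_selfadjoint_bound _ _ _ 1 yY Y0 ya Fp.
  by rewrite star1 !mulr1 mul1r Fa1 mulr1.
have := pos_functional_MinkowskiRe _ _ _ _ _ Fp (sqr_ge0 V) (sqr_ge0 W)
  (bound _ _ hV V0 ha) (bound _ _ kW W0 ka).
rewrite hkE; set T := h * h + k * k => hk; rewrite starZ conj_real -!scalerAl -!scalerAr !linearZ /= !Re_realM.
rewrite mulrA -expr2 sqrtrM ?sqr_ge0// sqrtr_sqr ger0_norm//.
rewrite ler_pM2l// -(@ler_sqr _ (Num.sqrt _)) ?nnegrE ?sqrtr_ge0 ?addr_ge0 ?sqr_ge0//.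
rewrite sqr_sqrtr//.
have [b ->] := a_pos.
by have := pos_functional_Re_ge0 Fp (b * T); rewrite starM !mulrA.
Qed.

Lemma anorm_anticomm_shift_bound (V W : R) x xs z F : is_aadjoint a x xs ->
  0 <= V -> 0 <= W ->
  (forall f, astates a f -> normc (f (a * x)) <= V) ->
  (forall f, astates a f -> normc (f (a * (x - z *: 1))) <= W) ->
  pos_functional F -> F a = 1 ->
  Num.sqrt (complex.Re (F (star (x * xs + xs * x) * a * (x * xs + xs * x)))) <=
  2 * (V ^+ 2 + W ^+ 2).
Proof.
move=> xsP V0 W0 xV xW Fp Fa1.
have [t [t1 tt tz]] := rotate_to_real z.
have -> : x * xs + xs * x =
    (t *: x) * (t^*%C *: xs) + (t^*%C *: xs) * (t *: x).
  by rewrite -!scalerAl -!scalerAr !scalerA tt mulrC tt !scale1r.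
apply: anorm_anticomm_bound => // [|f fa|f fa].
- by rewrite /is_aadjoint starZ -scalerAr -scalerAl xsP.
- have [G [Gp Ga fG]] := astates_functional _ fa.
  apply: le_trans (xV f fa); rewrite fG -scalerAr linearZ /=.
  by apply: le_trans (normr_Re_le_normc _) _; rewrite normcM t1 mul1r.
- have [G [Gp Ga fG]] := astates_functional _ fa.
  apply: le_trans (xW f fa).
  rewrite fG mulrBr -!scalerAr mulr1 linearZ linearB linearZ /= Ga mulr1.
  (* The shift costs only [t * z], which is real, because [G a = 1]. *)
  have -> : complex.Im (t * G (a * x)) = complex.Im (t * (G (a * x) - z)).
    by rewrite mulrBr raddfB /= tz subr0.
  by apply: le_trans (normr_Im_le_normc _) _; rewrite normcM t1 mul1r.
Qed.

End AStates.
End StarAlgebra.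

(** * Passage to the supremum over [astates a] and the infimum over shifts *)

Theorem theorem3p11 (R : realType) (A : cstarAlgType R) (a : A)
    (a_neq0 : a != 0) (a_pos : positive_elt a)
    (x : A) (xAa : aadjointable a x)
    (xs : A) (xsP : is_aadjoint a x xs) :
  ((4^-1)%:E * anorm a (x * xs + xs * x)%R
     <= (2^-1)%:E * (aradius a x ^+ 2 + adist a x ^+ 2)
     <= aradius a x ^+ 2)%E.
Proof.
have [[f0 f0a]|nof] := pselect (exists f, astates a f); last first.
  (* Both suprema are then [-oo], and [(-oo) ^ 2 = +oo]. *)
  have e : astates a = set0 :> set (A -> R[i]).
    by rewrite -subset0 => f fa; apply: nof; exists f.
  by rewrite /anorm /aradius e !image_set0 ereal_sup0 expe2 mulNyNy leey andbT
    gt0_muleNy ?lte_fin// leNye.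
have rad0 y : (0 <= aradius a y)%E.
  apply: le_trans (ereal_sup_ubound _); last by exists f0.
  by rewrite lee_fin; case: (f0 _) => p q; exact: sqrtr_ge0.
have dist0 : (0 <= adist a x)%E by apply: le_ereal_inf_tmp => _ [z _ <-].
have dist_le : (adist a x <= aradius a x)%E.
  apply: ereal_inf_lbound; exists 0 => //.
  by rewrite scale0r subr0.
have radP y f : astates a f -> ((Normc.normc (f (a * y)))%:E <= aradius a y)%E.
  by move=> fa; apply: ereal_sup_ubound; exists f.
case: (aradius a x) (rad0 x) (radP x) dist_le => [V| |] // V0 xV.
  have DP z : (adist a x <= aradius a (x - z *: 1)%R)%E.
    by apply: ereal_inf_lbound; exists z.
  have leD r : (forall z, (r%:E <= aradius a (x - z *: 1)%R)%E) -> (r%:E <= adist a x)%E.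
    by move=> rz; apply: le_ereal_inf_tmp => _ [z _ <-].
  case: (adist a x) dist0 leD {DP} => [D| |] // D0 leD.
  rewrite !lee_fin in V0 D0 *; rewrite -!EFin_expe -EFinD -EFinM => DV.
  have D2 : D ^+ 2 <= V ^+ 2 by rewrite ler_sqr ?nnegrE.
  apply/andP; split; last by lra.
  rewrite lee_pdivrMl// -EFinM; apply: ge_ereal_sup => _ [f fa <-].
  have [F [Fp Fa fF]] := astates_functional a_pos _ fa.
  rewrite lee_fin fF; set c := Num.sqrt _.
  suff : c / 2 - V ^+ 2 <= D ^+ 2 by lra.
  (* The infimum [D] need not be attained, so the bound is put as a lower bound for every shifted
     radius. A negative radicand is harmless: its root is [0]. *)
  suff rD : Num.sqrt (c / 2 - V ^+ 2) <= D.
    by rewrite -ler_sqrt ?sqr_ge0// sqrtr_sqr ger0_norm.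
  rewrite -lee_fin; apply: leD => z.
  case: (aradius a _) (rad0 (x - z *: 1)) (radP (x - z *: 1)) => [W| |] // W0 xW; last by rewrite leey.
  rewrite !lee_fin in W0 *.
  rewrite -[leRHS]ger0_norm// -sqrtr_sqr ler_wsqrtr//.
  have := anorm_anticomm_shift_bound a_pos _ _ _ _ z _ xsP V0 W0 xV xW Fp Fa.
  by rewrite -/c; lra.
move=> _.
(* Infinite radius: the squared distance is not [-oo], so the middle and right terms are both
   [+oo]. *)
rewrite leey andbT expe2 mulyy addye ?gt0_muley ?leey ?lte_fin//.
by rewrite -ltNye (lt_le_trans _ (sqre_ge0 _)).
Qed.
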